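(* Let $\underline{q}=(q_n)_{n\ge 1}$ be any increasing sequence of positive integers and let $\underline{u}=(u_n)_{n\ge 1}$ be any sequence of positive real numbers with $u_n\to\infty$. Then the set $\mathbb{Q}\cup{\sf S}_{\underline{q},\underline{u}}$ is a field (a subfield of $\mathbb{R}$).
   Context: For $x\in\mathbb{R}$, $\Vert x\Vert=\min_{m\in\mathbb{Z}}|x-m|$. A Liouville number is an irrational real $\xi$ such that for every integer $n\ge1$ there is a rational $p_n/q_n$ with $q_n\ge 2$ and $0<|\xi-p_n/q_n|\le q_n^{-n}$; $\mathbb{L}$ denotes the set of Liouville numbers. For an increasing sequence $\underline{q}=(q_n)$ of positive integers and a sequence $\underline{u}=(u_n)$ of positive reals tending to infinity, ${\sf S}_{\underline{q},\underline{u}}$ is the set of $\xi\in\mathbb{L}$ for which there exist constants $\kappa_1,\kappa_2>0$ and a sequence $(b_n)_{n\ge1}$ of positive integers with $1\le b_n\le q_n^{\kappa_1}$ and $\Vert b_n\xi\Vert\le q_n^{-\kappa_2 u_n}$ for every $n$. *)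

(* Defs.v *)
From mathcomp Require Import all_boot all_order all_algebra.
From mathcomp Require Import all_classical all_reals all_analysis.
Set Implicit Arguments.
Unset Strict Implicit.
Unset Printing Implicit Defensive.
Import Order.TTheory GRing.Theory Num.Theory.
Import numFieldNormedType.Exports.
Local Open Scope classical_set_scope.
Local Open Scope ring_scope.

(* The infimum is a minimum: see [dist_int_min] below. *)
Definition dist_int (R : realType) (x : R) : R :=
  inf [set `|x - m%:~R| | m in [set: int]].

Definition liouville (R : realType) : set R :=
  [set xi | irrational xi /\
    forall n : nat, (1 <= n)%N ->
      exists (p : int) (q : nat),
        [/\ (2 <= q)%N, 0 < `|xi - p%:~R / q%:R|
          & `|xi - p%:~R / q%:R| <= q%:R ^- n] ].

Definition liouville_set (R : realType) (q : nat -> nat) (u : nat -> R) :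
    set R :=
  [set xi | liouville xi /\
    exists (kappa1 kappa2 : R) (b : nat -> nat),
      [/\ 0 < kappa1, 0 < kappa2
        & forall n : nat,
            [/\ (1 <= b n)%N, (b n)%:R <= (q n)%:R `^ kappa1
              & dist_int ((b n)%:R * xi) <= (q n)%:R `^ (- (kappa2 * u n))] ] ].

Lemma dist_int_min (R : realType) (x : R) :
  exists m : int, dist_int x = `|x - m%:~R| /\
    forall k : int, `|x - m%:~R| <= `|x - k%:~R|.
Proof.
have [m hm] : exists m : int, forall k : int, `|x - m%:~R| <= `|x - k%:~R|.
  have fx := floor_le x; have xf := floorD1_gt x.
  have far (k : int) : x - (Num.floor x)%:~R <= `|x - k%:~R| \/
      (Num.floor x + 1)%:~R - x <= `|x - k%:~R|.
    have [kf|fk] := leP k (Num.floor x).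
      by left; rewrite (le_trans _ (ler_norm _))// lerB// ler_int.
    right; rewrite distrC (le_trans _ (ler_norm _))// lerB// ler_int.
    by rewrite lezD1.
  have [h|h] := leP (x - (Num.floor x)%:~R) ((Num.floor x + 1)%:~R - x).
    exists (Num.floor x) => k; rewrite ger0_norm ?subr_ge0//.
    by case: (far k) => [//|hk]; exact: le_trans h hk.
  exists (Num.floor x + 1) => k.
  rewrite distrC ger0_norm; last by rewrite subr_ge0 ltW.
  by case: (far k) => [hk|//]; exact: le_trans (ltW h) hk.
exists m; split => //; apply/eqP; rewrite eq_le; apply/andP; split.
  apply: ge_inf; last by exists m.
  by exists 0 => _ [k _ <-].
apply: lb_le_inf; first by exists `|x - m%:~R|, m.
by move=> _ [k _ <-].
Qed.

(* Main.v *)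
Require Import Defs.
From mathcomp Require Import all_boot all_order all_algebra.
From mathcomp Require Import all_classical all_reals all_analysis.
From mathcomp Require Import ring lra zify.
Set Implicit Arguments.
Unset Strict Implicit.
Import Order.TTheory GRing.Theory Num.Theory.
Import numFieldNormedType.Exports.
Local Open Scope classical_set_scope.
Local Open Scope ring_scope.

(* Being in the set means admitting, for all large n, integers 0 < b <= q_n^K and
   a with |b x - a| <= q_n^(-k u_n). Being Liouville is automatic for irrational
   such x, because q_n^(k u_n) eventually beats every power of b; and finitely
   many indices n can always be handled by b = 1, after decreasing k until
   q_n^(-k u_n) >= 1/2 there. If (b, a) and (b', a') serve x and y, then
   (b b', a b' - a' b) serves x - y, and (b a', a b') serves x / y since
     b a' (x / y) - a b' = (a' (b x - a) - a (b' y - a')) / y;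
   the constants and powers of q_n lost on the way are absorbed by halving k. *)

(** * Approximation by a single pair of integers *)

Definition approx_at {R : realType} (B e x : R) : Prop :=
  exists b a : int, [/\ 0 < b, b%:~R <= B & `|b%:~R * x - a%:~R| <= e].

(** A natural exponent [K] replaces the real kappa_1, so that bounds on denominators multiply as
    plain powers; asking only for large [n] lets constants be absorbed. *)
Definition well_approx {R : realType} (q : nat -> nat) (u : nat -> R) (x : R) :
    Prop :=
  exists (K : nat) (k : R), 0 < k /\
    \forall n \near \oo,
      approx_at ((q n)%:R ^+ K) ((q n)%:R `^ (- (k * u n))) x.

Lemma approx_at_le (R : realType) (B B' e e' x : R) :
  B <= B' -> e <= e' -> approx_at B e x -> approx_at B' e' x.
Proof.
move=> BB' ee' [b [a [b0 bB abx]]]; exists b, a.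
by split; [|exact: le_trans bB _|exact: le_trans abx _].
Qed.

Lemma approx_atB (R : realType) (B e x y : R) :
  approx_at B e x -> approx_at B e y ->
  approx_at (B * B) (2 * B * e) (x - y).
Proof.
move=> [b [a [b0 bB bax]]] [b' [a' [b'0 b'B bay]]].
have rb0 : (0 : R) < b%:~R by rewrite ltr0z.
have rb'0 : (0 : R) < b'%:~R by rewrite ltr0z.
exists (b * b'), (a * b' - a' * b); split; first exact: mulr_gt0.
  by rewrite intrM ler_pM// ltW.
rewrite intrB !intrM.
rewrite [X in `|X|](_ : _ = b'%:~R * (b%:~R * x - a%:~R)
  - b%:~R * (b'%:~R * y - a'%:~R)); last by ring.
rewrite (le_trans (ler_normB _ _))// !normrM (gtr0_norm rb0) (gtr0_norm rb'0).
rewrite (_ : 2 * B * e = B * e + B * e); last by ring.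
by rewrite lerD// ler_pM// ltW.
Qed.

(** In a quotient the numerator for [y] becomes a factor of the denominator, so numerators need a
    bound too: [a] is within [e <= 1 <= B] of [b x]. *)
Lemma approx_at_numerator (R : realType) (B e x : R) (b a : int) :
  0 < b -> b%:~R <= B -> 1 <= B -> e <= 1 -> `|b%:~R * x - a%:~R| <= e ->
  `|a%:~R| <= (`|x| + 1) * B.
Proof.
move=> b0 bB B1 e1 bax.
have rb0 : (0 : R) < b%:~R by rewrite ltr0z.
have -> : a%:~R = b%:~R * x - (b%:~R * x - a%:~R) by ring.
rewrite (le_trans (ler_normB _ _))// normrM gtr0_norm// mulrDl mul1r.
by rewrite lerD ?(le_trans bax) ?(le_trans e1)// mulrC ler_wpM2l.
Qed.

Lemma approx_at_div (R : realType) (B e x y : R) :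
  1 <= B -> e <= 1 -> e < `|y| ->
  approx_at B e x -> approx_at B e y ->
  approx_at ((`|y| + 1) * (B * B)) ((`|x| + `|y| + 2) / `|y| * B * e) (x / y).
Proof.
move=> B1 e1 ey [b [a [b0 bB bax]]] [b' [a' [b'0 b'B bay]]].
have rb0 : (0 : R) < b%:~R by rewrite ltr0z.
have rb'1 : (1 : R) <= b'%:~R by rewrite ler1z.
have aB := @approx_at_numerator _ _ _ _ _ _ b0 bB B1 e1 bax.
have a'B := @approx_at_numerator _ _ _ _ _ _ b'0 b'B B1 e1 bay.
have y0 : 0 < `|y| by rewrite (le_lt_trans _ ey)// (le_trans _ bay).
have yn0 : y != 0 by rewrite -normr_gt0.
(* Were [a'] zero, [b' >= 1] would give |y| <= b' |y| <= e < |y|. *)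
have a'0 : a' != 0.
  apply/eqP => a'0; move: bay; rewrite a'0 subr0 normrM gtr0_norm; last by lra.
  apply/negP; rewrite -ltNge (lt_le_trans ey)// ler_peMl//.
have main : `|(b * a')%:~R * (x / y) - (a * b')%:~R| <=
    (`|x| + `|y| + 2) / `|y| * B * e.
  rewrite !intrM.
  rewrite [X in `|X|](_ : _ = (a'%:~R * (b%:~R * x - a%:~R)
    - a%:~R * (b'%:~R * y - a'%:~R)) / y); last by field.
  rewrite normrM normfV.
  (* The constant |x| + |y| + 2 is the sum of the factors |y| + 1 and |x| + 1 from the bounds on
     [a'] and [a]. *)
  rewrite (_ : _ * e = ((`|y| + 1) * B * e + (`|x| + 1) * B * e) / `|y|);
    last by field; rewrite gt_eqF.
  rewrite ler_pM2r ?invr_gt0// (le_trans (ler_normB _ _))// !normrM.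
  by rewrite lerD// ler_pM.
have ba'B : `|(b * a')%:~R| <= (`|y| + 1) * (B * B).
  rewrite intrM normrM gtr0_norm// mulrCA.
  by rewrite ler_pM// ltW.
(* The denominator must be positive, so both [b a'] and [a b'] change sign when [a' < 0]. *)
have [a'p|a'n|/eqP] := ltgtP a' 0; last by rewrite (negbTE a'0).
- exists (- (b * a')), (- (a * b')); split.
  + by rewrite oppr_gt0 pmulr_rlt0.
  + by rewrite rmorphN (le_trans (ler_norm _))// normrN.
  + by rewrite !rmorphN mulNr -opprD normrN.
- exists (b * a'), (a * b'); split => //; first exact: mulr_gt0.
  by rewrite (le_trans (ler_norm _)).
Qed.

(** * Growth of the powers of q_n and absorption of constants *)

(** q_0 may be 1, but q_n >= 2 from n = 1 on; as 2^K > K, any natural K >= |C| will do. *)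
Lemma near_le_exp (R : realType) (q : nat -> nat) (C : R) :
  (forall n, (0 < q n)%N) -> {homo q : m n / (m < n)%N} ->
  exists K : nat, \forall n \near \oo, C <= (q n)%:R ^+ K.
Proof.
move=> q_pos q_incr; exists (Num.bound `|C|); near=> n.
have q2 : (2 <= q n)%N.
  have n1 : (0 < n)%N by near: n; exact: nbhs_infty_gt.
  exact: leq_ltn_trans (q_pos 0%N) (q_incr _ _ n1).
rewrite (le_trans (ler_norm _))//.
rewrite (le_trans (ltW (archi_boundP (normr_ge0 C))))//.
rewrite -natrX ler_nat (leq_trans (ltnW (ltn_expl _ (ltnSn 1))))//.
by case: (Num.bound _) => // m; rewrite leq_exp2r.
Unshelve. all: by end_near. Qed.

(** Once C <= q_n^L, it is enough that u_n >= (L + K) / k, which holds eventually. *)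
Lemma near_exp_le_powR (R : realType) (q : nat -> nat) (u : nat -> R)
    (C k : R) (K : nat) :
  (forall n, (0 < q n)%N) -> {homo q : m n / (m < n)%N} ->
  u n @[n --> \oo] --> +oo -> 0 < k ->
  \forall n \near \oo, C * (q n)%:R ^+ K <= (q n)%:R `^ (k * u n).
Proof.
move=> q_pos q_incr u_infty k0.
have [L CL] := @near_le_exp R q C q_pos q_incr.
near=> n.
have q1 : 1 <= (q n)%:R :> R by rewrite ler1n.
have un : (L + K)%:R / k <= u n.
  by near: n; move/cvgryPge : u_infty; apply.
rewrite (@le_trans _ _ ((q n)%:R ^+ (L + K)))//.
  by rewrite exprD ler_wpM2r ?exprn_ge0//; near: n.
by rewrite -powR_mulrn// ler_powR// mulrC -ler_pdivrMr.
Unshelve. all: by end_near. Qed.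

(** [C] is absorbed by a larger exponent of the denominator bound, and D q_n^L by half of [k], since
    q_n^(k u_n / 2) eventually exceeds it. *)
Lemma well_approx_near (R : realType) (q : nat -> nat) (u : nat -> R)
    (C D k x : R) (K L : nat) :
  (forall n, (0 < q n)%N) -> {homo q : m n / (m < n)%N} ->
  u n @[n --> \oo] --> +oo -> 0 < k ->
  (\forall n \near \oo, approx_at (C * (q n)%:R ^+ K)
    (D * (q n)%:R ^+ L * (q n)%:R `^ (- (k * u n))) x) ->
  well_approx q u x.
Proof.
move=> q_pos q_incr u_infty k0 H.
have [M CM] := @near_le_exp R q C q_pos q_incr.
have k20 : 0 < k / 2 by lra.
have DL := @near_exp_le_powR R q u D (k / 2) L q_pos q_incr u_infty k20.
exists (M + K)%N, (k / 2); split => //; near=> n.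
have q0 : 0 < (q n)%:R :> R by rewrite ltr0n.
apply: (@approx_at_le R (C * (q n)%:R ^+ K) _
    (D * (q n)%:R ^+ L * (q n)%:R `^ (- (k * u n)))); last by near: n.
  by rewrite exprD ler_wpM2r ?exprn_ge0//; near: n.
rewrite [leRHS](_ : _ = (q n)%:R `^ (k / 2 * u n) * (q n)%:R `^ (- (k * u n))).
  by rewrite ler_wpM2r ?powR_ge0//; near: n.
rewrite -powRD; last by rewrite (gt_eqF q0) implybT.
by congr (_ `^ _); field.
Unshelve. all: by end_near. Qed.

(** * Closure under subtraction and division *)

Lemma well_approx_common (R : realType) (q : nat -> nat) (u : nat -> R)
    (x y : R) :
  (forall n, (0 < q n)%N) -> (forall n, 0 < u n) ->
  well_approx q u x -> well_approx q u y ->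
  exists (K : nat) (k : R), 0 < k /\
    \forall n \near \oo,
      approx_at ((q n)%:R ^+ K) ((q n)%:R `^ (- (k * u n))) x /\
      approx_at ((q n)%:R ^+ K) ((q n)%:R `^ (- (k * u n))) y.
Proof.
move=> q_pos u_pos [K [k [k0 Hx]]] [K' [k' [k'0 Hy]]].
exists (maxn K K'), (Num.min k k'); split; first by rewrite lt_min k0.
near=> n.
have q1 : 1 <= (q n)%:R :> R by rewrite ler1n.
split.
- apply: (@approx_at_le R ((q n)%:R ^+ K) _ ((q n)%:R `^ (- (k * u n)))).
  + by rewrite ler_weXn2l// leq_maxl.
  + by rewrite ler_powR// lerN2 ler_pM2r// ge_min lexx.
  + by near: n.
- apply: (@approx_at_le R ((q n)%:R ^+ K') _ ((q n)%:R `^ (- (k' * u n)))).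
  + by rewrite ler_weXn2l// leq_maxr.
  + by rewrite ler_powR// lerN2 ler_pM2r// ge_min lexx orbT.
  + by near: n.
Unshelve. all: by end_near. Qed.

Lemma well_approxB (R : realType) (q : nat -> nat) (u : nat -> R) (x y : R) :
  (forall n, (0 < q n)%N) -> {homo q : m n / (m < n)%N} ->
  (forall n, 0 < u n) -> u n @[n --> \oo] --> +oo ->
  well_approx q u x -> well_approx q u y -> well_approx q u (x - y).
Proof.
move=> q_pos q_incr u_pos u_infty Hx Hy.
have [K [k [k0 H]]] := well_approx_common q_pos u_pos Hx Hy.
apply: (@well_approx_near R q u 1 2 k (x - y) (K + K) K) => //.
near=> n; rewrite mul1r exprD.
have [Hxn Hyn] : approx_at ((q n)%:R ^+ K) ((q n)%:R `^ (- (k * u n))) x /\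
    approx_at ((q n)%:R ^+ K) ((q n)%:R `^ (- (k * u n))) y by near: n.
exact: approx_atB.
Unshelve. all: by end_near. Qed.

Lemma rational_well_approx (R : realType) (q : nat -> nat) (u : nat -> R)
    (x : R) :
  (forall n, (0 < q n)%N) -> {homo q : m n / (m < n)%N} ->
  rational x -> well_approx q u x.
Proof.
move=> q_pos q_incr /rationalP[a [b xab]].
have [b' [a' [b'0 E]]] : exists b' a' : int, 0 < b' /\ b'%:~R * x = a'%:~R.
  (* [rationalP] allows the denominator 0, and then x = a / 0 = 0. *)
  have [b0|b0] := posnP b.
    by exists 1, 0; rewrite xab b0 invr0 !mulr0.
  exists (Posz b), a; split => //.
  by rewrite xab mulrC divfK// pnatr_eq0 -lt0n.
have [K HK] := @near_le_exp R q b'%:~R q_pos q_incr.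
exists K, 1; split => //; near=> n.
exists b', a'; split => //; first by near: n.
by rewrite E subrr normr0 powR_ge0.
Unshelve. all: by end_near. Qed.

Lemma well_approx_div (R : realType) (q : nat -> nat) (u : nat -> R) (x y : R) :
  (forall n, (0 < q n)%N) -> {homo q : m n / (m < n)%N} ->
  (forall n, 0 < u n) -> u n @[n --> \oo] --> +oo ->
  well_approx q u x -> well_approx q u y -> well_approx q u (x / y).
Proof.
move=> q_pos q_incr u_pos u_infty Hx Hy.
have [->|y0] := eqVneq y 0.
  rewrite invr0 mulr0; apply: rational_well_approx => //.
  by apply/rationalP; exists 0, 1%N; rewrite mul0r.
have [K [k [k0 H]]] := well_approx_common q_pos u_pos Hx Hy.
apply: (@well_approx_near R q u (`|y| + 1) ((`|x| + `|y| + 2) / `|y|)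
  k (x / y) (K + K) K) => //.
(* With exponent 0 this reads 2 / |y| <= q_n^(k u_n): the error is eventually at most |y| / 2, hence
   strictly below |y| as [approx_at_div] requires. *)
have He := @near_exp_le_powR R q u (2 / `|y|) k 0 q_pos q_incr u_infty k0.
near=> n; rewrite exprD.
have q1 : 1 <= (q n)%:R :> R by rewrite ler1n.
have [Hxn Hyn] : approx_at ((q n)%:R ^+ K) ((q n)%:R `^ (- (k * u n))) x /\
    approx_at ((q n)%:R ^+ K) ((q n)%:R `^ (- (k * u n))) y by near: n.
have yp : 0 < `|y| by rewrite normr_gt0.
apply: approx_at_div => //.
- by rewrite exprn_ege1.
- by rewrite -[leRHS](powRr0 (q n)%:R) ler_powR// oppr_le0 ltW// mulr_gt0.
- rewrite powRN.
  have Hn : 2 / `|y| <= (q n)%:R `^ (k * u n).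
    by rewrite -[leLHS]mulr1 -(expr0 (q n)%:R); near: n.
  rewrite invf_plt ?posrE//; last by rewrite powR_gt0 ?ltr0n.
  by rewrite (lt_le_trans _ Hn)// ltr_pMl ?invr_gt0// ltr1n.
Unshelve. all: by end_near. Qed.

(** * Return to Liouville numbers and the distance to the integers *)

Lemma well_approx_liouville (R : realType) (q : nat -> nat) (u : nat -> R)
    (x : R) :
  (forall n, (0 < q n)%N) -> {homo q : m n / (m < n)%N} ->
  u n @[n --> \oo] --> +oo ->
  irrational x -> well_approx q u x -> liouville x.
Proof.
move=> q_pos q_incr u_infty xirr [K [k [k0 H]]]; split => // m m1.
(* The factor 2^m pays for a doubled denominator: (2 b)^m <= 2^m q_N^(K m) <= q_N^(k u_N). *)
have Hm := @near_exp_le_powR R q u (2 ^+ m) k (K * m) q_pos q_incr u_infty k0.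
have [N _ /(_ N (leqnn N))[/= [b [a [b0 bB bax]]] qm]] := filterI H Hm.
have rb1 : (1 : R) <= b%:~R by rewrite ler1z.
have babs : (`|b|%N)%:R = b%:~R :> R by rewrite natr_absz gtr0_norm.
have q0 : 0 < (q N)%:R :> R by rewrite ltr0n.
(* [b] may be 1, whereas a Liouville denominator must be at least 2. *)
exists (2 * a), (2 * `|b|)%N; split; first by lia.
  rewrite normr_gt0 subr_eq0; apply/eqP => xE.
  by apply: xirr; apply/rationalP; exists (2 * a), (2 * `|b|)%N.
rewrite natrM babs intrM.
rewrite [X in `|X|](_ : _ = (b%:~R * x - a%:~R) / b%:~R); last first.
  by field; rewrite gt_eqF// ltr0z.
rewrite normrM normfV (gtr0_norm (lt_le_trans ltr01 rb1)).
rewrite (@le_trans _ _ ((q N)%:R `^ (- (k * u N))))//.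
  rewrite (le_trans _ bax)// ler_piMr// invf_le1//.
  exact: lt_le_trans rb1.
rewrite powRN lef_pV2 ?posrE ?powR_gt0 ?exprn_gt0 ?mulr_gt0//; last first.
  exact: lt_le_trans rb1.
rewrite (le_trans _ qm)// exprMn exprM ler_wpM2l ?exprn_ge0//.
by rewrite lerXn2r ?nnegrE ?exprn_ge0// ltW// (lt_le_trans _ rb1).
Qed.

Lemma dist_int_le (R : realType) (x : R) (m : int) : dist_int x <= `|x - m%:~R|.
Proof. by have [m0 [-> ]] := dist_int_min x; apply. Qed.

Lemma dist_int_le_half (R : realType) (x : R) : dist_int x <= 2^-1.
Proof.
have [m [-> hm]] := dist_int_min x.
(* If the nearest integer [m] were farther than 1/2, one of its two neighbours would be nearer. *)
have := hm (m + 1); have := hm (m - 1); rewrite intrB intrD !mulr1z.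
by case: (ger0P (x - m%:~R)) => ?;
  case: (ger0P (x - (m%:~R - 1))) => ?;
  case: (ger0P (x - (m%:~R + 1))) => ? ? ?; lra.
Qed.

(** q_n^(-k u_n) = exp(-k u_n ln q_n) >= 1 - k u_n ln q_n. With [s] the sum of all u_i ln q_i for i
    < N, k = 1 / (2 (s + 1)) makes the subtracted term at most 1/2; the + 1 covers s = 0. *)
Lemma half_le_powR_prefix (R : realType) (q : nat -> nat) (u : nat -> R)
    (N : nat) :
  (forall n, (0 < q n)%N) -> (forall n, 0 < u n) ->
  exists2 k : R, 0 < k & forall n, (n < N)%N ->
    2^-1 <= (q n)%:R `^ (- (k * u n)).
Proof.
move=> q_pos u_pos.
have un0 n : 0 <= u n * ln (q n)%:R.
  by rewrite mulr_ge0 ?ln_ge0 ?ler1n// ltW.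
pose s := \sum_(i < N) u i * ln (q i)%:R.
have s0 : 0 <= s by apply: sumr_ge0.
exists (2 * (s + 1))^-1; first by rewrite invr_gt0; lra.
move=> n nN; rewrite /powR pnatr_eq0 -leqn0 leqNgt q_pos/=.
apply: le_trans (expR_ge1Dx _).
have us : u n * ln (q n)%:R <= s.
  by rewrite /s (bigD1 (Ordinal nN))//= lerDl sumr_ge0.
rewrite mulNr -mulrA.
suff : (2 * (s + 1))^-1 * (u n * ln (q n)%:R) <= 2^-1 by lra.
by rewrite mulrC ler_pdivrMr; lra.
Qed.

(** A difference or quotient of two Liouville numbers may be rational; the single condition
    [well_approx] spares the closure proofs this case distinction. *)
Lemma mem_rational_liouville (R : realType) (q : nat -> nat) (u : nat -> R)
    (x : R) :
  (forall n, (0 < q n)%N) -> {homo q : m n / (m < n)%N} ->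
  (forall n, 0 < u n) -> u n @[n --> \oo] --> +oo ->
  (@rational R `|` liouville_set q u) x <-> well_approx q u x.
Proof.
move=> q_pos q_incr u_pos u_infty; split.
  case=> [|[_ [k1 [k2 [b [k10 k20 H]]]]]]; first exact: rational_well_approx.
  exists (Num.bound k1), k2; split => //; apply: nearW => n.
  have [b1 bq bx] := H n.
  have [m [mE _]] := dist_int_min ((b n)%:R * x).
  exists (Posz (b n)), m; split => //; last by rewrite -mE.
  rewrite (le_trans bq)// -powR_mulrn// ler_powR ?ler1n//.
  exact/ltW/archi_boundP/ltW.
move=> H; have [xrat|xirr] := pselect (rational x); first by left.
right; split; first exact: well_approx_liouville H.
have {H}[K [k [k0 [N _ H]]]] := H.
have [k' k'0 Hk'] := @half_le_powR_prefix R q u N q_pos u_pos.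
(* K + 1 is positive even when K = 0; the minimum serves both the indices below [N] and those from
   [N] on. *)
exists (K%:R + 1), (Num.min k k').
suff /choice[b Hb] : forall n, exists b : nat, [/\ (1 <= b)%N,
    b%:R <= (q n)%:R `^ (K%:R + 1) :> R &
    dist_int (b%:R * x) <= (q n)%:R `^ (- (Num.min k k' * u n))].
  by exists b; split => //; rewrite ?ltr_wpDl ?lt_min ?k0.
move=> n; have q1 : 1 <= (q n)%:R :> R by rewrite ler1n.
have [nN|Nn] := ltnP n N.
  exists 1%N; split => //.
    by rewrite -[leLHS](powRr0 (q n)%:R) ler_powR// addr_ge0.
  rewrite (le_trans (dist_int_le_half _))// (le_trans (Hk' n nN))//.
  by rewrite ler_powR// lerN2 ler_pM2r// ge_min lexx orbT.
have [b [a [b0 bB bax]]] := H n Nn.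
have babs : (`|b|%N)%:R = b%:~R :> R by rewrite natr_absz gtr0_norm.
exists `|b|%N; split; first by lia.
  by rewrite babs (le_trans bB)// -powR_mulrn// ler_powR// lerDl.
rewrite babs (le_trans (dist_int_le _ a))// (le_trans bax)//.
by rewrite ler_powR// lerN2 ler_pM2r// ge_min lexx.
Qed.

(* [GRing.divring_closed S]: 1 \in S and S is closed under subtraction and
   division; in a field (where x / 0 = 0) this says that S is a subfield. *)
Theorem theorem1p2 (R : realType) (q : nat -> nat) (u : nat -> R)
    (q_pos : forall n : nat, (0 < q n)%N)
    (q_incr : {homo q : m n / (m < n)%N})
    (u_pos : forall n : nat, 0 < u n)
    (u_infty : u n @[n --> \oo] --> +oo) :
  GRing.divring_closed (mem (@rational R `|` liouville_set q u)).
Proof.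
have memE z : (z \in mem (@rational R `|` liouville_set q u)) <->
    well_approx q u z.
  rewrite -mem_rational_liouville//.
  by split; [move/set_mem | move=> ?; apply/mem_set].
split.
- apply/memE/rational_well_approx => //.
  by apply/rationalP; exists 1, 1%N; rewrite divr1.
- by move=> x y /memE Hx /memE Hy; apply/memE/well_approxB.
- by move=> x y /memE Hx /memE Hy; apply/memE/well_approx_div.
Qed.
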